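(* Let $\mathcal{M}$ be a smooth manifold, and for each $i\in\{1,\dots,N\}$ let $\{f_{i,j}\}_{j=1}^{d_i}$ be smooth vector fields on $\mathcal{M}$ and $J_i:\mathcal{M}\to\mathbb{R}$ a smooth function. Let $\mathcal{U}\subset\mathcal{M}$ be an open submanifold such that, with $\mathcal{E}_i(x):=\mathrm{span}_{\mathbb{R}}\{f_{i,j}(x)\}_{j=1}^{d_i}$, each $\mathcal{E}_i$ is a regular distribution on $\mathcal{U}$ and $T_x\mathcal{U}=\mathcal{E}_1(x)\oplus\cdots\oplus\mathcal{E}_N(x)$ for all $x\in\mathcal{U}$. Let $x^\star\in\mathcal{U}$ satisfy $\mathrm{grad}_{\mathcal{E}_i}(J_i)|_{x^\star}=0$ for all $i$, and let $A_{ij}$ be the blocks of the intrinsic Jacobian $A$. Suppose that there exist constants $\chi_i>0$ ($i=1,\dots,N$) such that, for each $i$, $$\inf_{s\in\mathbb{C},\,\Re(s)\ge0}\sigma_{\min}^g\big(A_{ii}|_{x^\star}-sI_i\big)\;>\;\sum_{j\ne i}\|A_{ij}|_{x^\star}\|_g\,\frac{\chi_j}{\chi_i},$$ where $I_i$ is the identity map on $\mathcal{E}_i(x^\star)$. Then $A|_{x^\star}$ is an automorphism of $T_{x^\star}\mathcal{U}$ and is Hurwitz (all its eigenvalues have strictly negative real part).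
   Context: A regular distribution is a smooth distribution of constant rank. $g$ denotes the Riemannian metric on $\mathcal{U}$ whose co-metric is $$g_x^{-1}(\alpha,\beta)=\sum_{i=1}^N\sum_{j=1}^{d_i}\alpha(f_{i,j}(x))\,\beta(f_{i,j}(x)),\qquad \alpha,\beta\in T_x^*\mathcal{U};$$ with respect to it the subbundles $\mathcal{E}_1,\dots,\mathcal{E}_N$ are mutually orthogonal. $\nabla$ is its Levi-Civita connection, $P_{\mathcal{E}_i}$ the $g$-orthogonal projection onto $\mathcal{E}_i$, $\mathrm{grad}(J)$ the $g$-gradient and $\mathrm{grad}_{\mathcal{E}_i}(J):=P_{\mathcal{E}_i}\mathrm{grad}(J)$. The intrinsic Jacobian is the $(1,1)$-tensor $A[X]:=\nabla_X\big(\sum_{i=1}^N\mathrm{grad}_{\mathcal{E}_i}(J_i)\big)$, and its blocks are $$A_{ij}[\cdot]=P_{\mathcal{E}_i}\big[\nabla_{P_{\mathcal{E}_j}[\cdot]}\mathrm{grad}(J_i)\big]+\sum_{k=1}^NP_{\mathcal{E}_i}\big[(\nabla_{P_{\mathcal{E}_j}[\cdot]}P_{\mathcal{E}_k})[\mathrm{grad}(J_k)]\big],$$ i.e. $A_{ij}=P_{\mathcal{E}_i}AP_{\mathcal{E}_j}$, with $A_{ij}|_{x^\star}$ regarded as a map $\mathcal{E}_j(x^\star)\to\mathcal{E}_i(x^\star)$. $\|A_{ij}\|_g:=\sup_{v\in\mathcal{E}_j(x^\star)\setminus\{0\}}\|A_{ij}v\|_g/\|v\|_g$. For a linear map $M$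 on $\mathcal{E}_i(x^\star)$, extended where needed (for complex $s$) to the complexification of $\mathcal{E}_i(x^\star)$ with the induced Hermitian norm, $\sigma_{\min}^g(M):=\inf_{v\ne0}\|Mv\|_g/\|v\|_g$, the infimum being over nonzero vectors of that complexification. *)

(* Defs.v *)
From HB Require Import structures.
From mathcomp Require Import all_boot all_order all_algebra.
From mathcomp Require Import all_classical all_reals all_analysis.
From mathcomp Require Import complex.
Import Order.TTheory GRing.Theory Num.Theory.
Import numFieldNormedType.Exports.

Set Implicit Arguments.
Unset Strict Implicit.
Unset Printing Implicit Defensive.

Local Open Scope classical_set_scope.
Local Open Scope ring_scope.

(* Vectors are rows: a linear map of R^n given by a matrix B is v |-> v *m B,  *)
(* so that "first B1, then B2" is B1 *m B2.                                    *)

Section EuclideanSmoothness.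
Variables (R : realType) (n : nat).
Implicit Types (W : set 'rV[R]_n) (h : 'rV[R]_n -> R).

(* For open W, h is of class C^k on W; only the values of h on W matter. *)
Fixpoint Ck (k : nat) W h : Prop :=
  (forall p, W p -> {for p, continuous h}) /\
  if k is k'.+1 then
    forall j : 'I_n,
      (forall p, W p -> derivable h p (delta_mx 0 j)) /\
      Ck k' W (fun p => 'D_(delta_mx 0 j) h p)
  else True.

Definition Csmooth W h : Prop := forall k, Ck k W h.

End EuclideanSmoothness.

(* Only the restrictions chart_map : chart_dom -> chart_cod and                *)
(* chart_inv : chart_cod -> chart_dom carry information.                       *)
Record chart (R : realType) (n : nat) (M : topologicalType) := Chart {
  chart_dom : set M;
  chart_cod : set 'rV[R]_n;
  chart_map : M -> 'rV[R]_n;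
  chart_inv : 'rV[R]_n -> M;
  chart_dom_open : open chart_dom;
  chart_cod_open : open chart_cod;
  chart_map_cod : forall x, chart_dom x -> chart_cod (chart_map x);
  chart_inv_dom : forall p, chart_cod p -> chart_dom (chart_inv p);
  chart_mapK : forall x, chart_dom x -> chart_inv (chart_map x) = x;
  chart_invK : forall p, chart_cod p -> chart_map (chart_inv p) = p;
  chart_map_continuous :
    forall x, chart_dom x -> {for x, continuous chart_map};
  chart_inv_continuous :
    forall p, chart_cod p -> {for p, continuous chart_inv}
}.

(* The atlas need not be maximal.  chart_at selects a chart of the atlas       *)
(* around each point; it is used to represent the tangent space at x by R^n.   *)
Record smoothManifold (R : realType) (n : nat) := SmoothManifold {
  carrier :> topologicalType;
  manifold_hausdorff : hausdorff_space carrier;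
  manifold_second_countable : @second_countable carrier;
  atlas : set (chart R n carrier);
  chart_at : carrier -> chart R n carrier;
  chart_at_atlas : forall x, atlas (chart_at x);
  chart_at_dom : forall x, chart_dom (chart_at x) x;
  atlas_compatible : forall c c', atlas c -> atlas c' -> forall k : 'I_n,
    Csmooth (chart_map c @` (chart_dom c `&` chart_dom c'))
            (fun p => chart_map c' (chart_inv c p) 0 k)
}.

Section Calculus.
Variables (R : realType) (n : nat) (M : smoothManifold R n).
Implicit Types (U : set M) (h : M -> R) (x : M).

Definition smooth_fun U h : Prop := forall c, atlas c ->
  Csmooth (chart_map c @` (U `&` chart_dom c)) (h \o chart_inv c).

(* A tangent vector at x is given by its components in the chart chart_at x.   *)
(* Thus T_x M is 'rV[R]_n, and a covector at x is a column a, acting on v by   *)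
(* v *m a.                                                                     *)
Definition vfield : Type := M -> 'rV[R]_n.

(* The derivative v(h) of h along the tangent vector v at x. *)
Definition dird x (v : 'rV[R]_n) h : R :=
  'D_v (h \o chart_inv (chart_at x)) (chart_map (chart_at x) x).

(* The components X(c^k) of X in every chart c of the atlas are smooth. *)
Definition smooth_vfield U (X : vfield) : Prop :=
  forall c, atlas c -> forall k : 'I_n,
    smooth_fun (U `&` chart_dom c)
               (fun x => dird x (X x) (fun y => chart_map c y 0 k)).

(* Bilinear forms on the tangent spaces, as Gram matrices. *)
Definition gdot (G : 'M[R]_n) (u v : 'rV[R]_n) : R := (u *m G *m v^T) 0 0.

Definition gnorm (G : 'M[R]_n) (v : 'rV[R]_n) : R := Num.sqrt (gdot G v v).

(* The vector field dual to dh: gdot (g x) (grad g h x) v = dird x v h. *)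
Definition grad (g : M -> 'M[R]_n) h : vfield := fun x =>
  (\row_k dird x (delta_mx 0 k) h) *m invmx (g x).

(* A connection on U, as the operator taking a vector field Y to the           *)
(* (1,1)-tensor nabla Y : v |-> nabla_v Y on each tangent space.  Its values   *)
(* on fields that are not smooth on U, and at points outside U, are arbitrary. *)
Definition connection : Type := vfield -> M -> 'M[R]_n.

Definition covd (nabla : connection) x (v : 'rV[R]_n) (Y : vfield) : 'rV[R]_n :=
  v *m nabla Y x.

Definition affine_connection U (nabla : connection) : Prop :=
  [/\ forall X Y, smooth_vfield U X -> smooth_vfield U Y ->
        smooth_vfield U (fun x => covd nabla x (X x) Y),
      forall Y Z, smooth_vfield U Y -> smooth_vfield U Z ->
        forall x v, U x ->
        covd nabla x v (fun y => Y y + Z y) = covd nabla x v Y + covd nabla x v Z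
    & forall h Y, smooth_fun U h -> smooth_vfield U Y ->
        forall x v, U x ->
        covd nabla x v (fun y => h y *: Y y) =
          dird x v h *: Y x + h x *: covd nabla x v Y].

(* nabla_X Y - nabla_Y X = [X, Y], as derivations of smooth functions on U. *)
Definition torsion_free U (nabla : connection) : Prop :=
  forall X Y h, smooth_vfield U X -> smooth_vfield U Y -> smooth_fun U h ->
  forall x, U x ->
    dird x (covd nabla x (X x) Y - covd nabla x (Y x) X) h =
      dird x (X x) (fun y => dird y (Y y) h)
      - dird x (Y x) (fun y => dird y (X y) h).

Definition metric_compatible U (g : M -> 'M[R]_n) (nabla : connection) : Prop :=
  forall Y Z, smooth_vfield U Y -> smooth_vfield U Z ->
  forall x v, U x ->
    dird x v (fun y => gdot (g y) (Y y) (Z y)) =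
      gdot (g x) (covd nabla x v Y) (Z x) + gdot (g x) (Y x) (covd nabla x v Z).

Definition levi_civita U (g : M -> 'M[R]_n) (nabla : connection) : Prop :=
  [/\ affine_connection U nabla, torsion_free U nabla
    & metric_compatible U g nabla].

(* The row space of [span_of X x] is the span of the vectors X j x. *)
Definition span_of m (X : 'I_m -> vfield) x : 'M[R]_(m, n) :=
  \matrix_(j < m) X j x.

Definition regular_distribution U m (X : 'I_m -> vfield) : Prop :=
  (forall j, smooth_vfield U (X j)) /\
  exists r : nat, forall x, U x -> \rank (span_of X x) = r.

(* The projection onto the row space of E along its G-orthogonal               *)
(* {v | gdot G v w = 0 for all w in E}.                                        *)
Definition orth_proj (G : 'M[R]_n) m (E : 'M[R]_(m, n)) : 'M[R]_n :=
  proj_mx <<E>>%MS (kermx (G *m E^T)).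

Section IntrinsicJacobian.
Variables (N : nat) (d : 'I_N -> nat) (f : forall i, 'I_(d i) -> vfield).
Variable J : 'I_N -> M -> R.

(* For covectors a and b, a^T *m cometric x *m b is the sum over i, j of       *)
(* a(f_ij(x)) b(f_ij(x)).                                                      *)
Definition cometric x : 'M[R]_n :=
  \sum_(i < N) \sum_(j < d i) (f j x)^T *m f j x.

Definition metric x : 'M[R]_n := invmx (cometric x).

Definition sub_proj (i : 'I_N) x : 'M[R]_n :=
  orth_proj (metric x) (span_of (@f i) x).

Definition sub_grad (i : 'I_N) : vfield :=
  fun x => grad metric (J i) x *m sub_proj i x.

Definition intrinsic_jacobian (nabla : connection) : M -> 'M[R]_n :=
  nabla (fun x => \sum_(i < N) sub_grad i x).

(* P_i A P_j, i.e. P_j is applied first. *)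
Definition jacobian_block (nabla : connection) (i j : 'I_N) x : 'M[R]_n :=
  sub_proj j x *m intrinsic_jacobian nabla x *m sub_proj i x.

End IntrinsicJacobian.

End Calculus.

Section Norms.
Variables (R : realType) (n : nat).
Implicit Types G : 'M[R]_n.

(* Norm of the restriction of B to E; it is 0 when E = 0, as sup set0 = 0. *)
Definition opnorm G m (E : 'M[R]_(m, n)) (B : 'M[R]_n) : R :=
  sup [set gnorm G (v *m B) / gnorm G v |
         v in [set v : 'rV[R]_n | (v <= E)%MS /\ v != 0]].

Definition complexify m (B : 'M[R]_(m, n)) : 'M[R[i]]_(m, n) :=
  map_mx (real_complex R) B.

Definition hnorm G (z : 'rV[R[i]]_n) : R :=
  Num.sqrt (complex.Re ((z *m complexify G *m (map_mx (@conjc R) z)^T) 0 0)).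

(* The infimum over nonzero z in the complexification of E; it is +oo when     *)
(* E = 0.                                                                      *)
Definition sigma_min G m (E : 'M[R]_(m, n)) (B : 'M[R[i]]_n) : \bar R :=
  ereal_inf [set (hnorm G (z *m B) / hnorm G z)%:E |
               z in [set z : 'rV[R[i]]_n | (z <= complexify E)%MS /\ z != 0]].

Definition hurwitz (B : 'M[R]_n) : Prop :=
  forall s : R[i], eigenvalue (complexify B) s -> complex.Re s < 0.

End Norms.

(* Main.v *)
Require Import Defs.
From HB Require Import structures.
From mathcomp Require Import all_boot all_order all_algebra.
From mathcomp Require Import all_classical all_reals all_analysis.
From mathcomp Require Import complex.
From mathcomp Require Import ring lra.
Import Order.TTheory GRing.Theory Num.Theory.
Import numFieldNormedType.Exports.
Import Defs.
Local Open Scope classical_set_scope.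
Local Open Scope ring_scope.

Set Implicit Arguments.
Unset Strict Implicit.

(** The statement concerns a single tangent space: it is a block version of
    the Gershgorin (diagonal dominance) argument for the matrix [A] of the
    intrinsic Jacobian at the critical point, in the inner product [g].

    Suppose that [z] is a nonzero complex vector with [z A = s z] and
    [Re s >= 0].  Put [z_j = z P_j], where [P_j] is the orthogonal projection
    onto [E_j].  Since the projections add up to the identity, [z] is the sum
    of the [z_j], and projecting the eigenvalue equation onto [E_i] gives
    [z_i (A_ii - s) = - sum_(j != i) z_j A_ij].  Choose [i] such that
    [|z_i| / chi_i] is maximal, which makes [z_i] nonzero.  The left-hand side
    is at least [sigma_min (A_ii - s) |z_i|]; the right-hand side is at most
    [sum_(j != i) |A_ij| |z_j|], hence at most
    [sum_(j != i) |A_ij| (chi_j / chi_i) |z_i|].  This contradicts the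
    dominance hypothesis at [i].  So every eigenvalue has negative real part
    ([block_dominance_hurwitz]), and [A] is invertible because [0] is not an
    eigenvalue ([hurwitz_unit]).

    Two points need work.  First, the operator norms are suprema over real
    vectors while the [z_j] are complex: the Hermitian norm of [x + i y] is
    the square root of [|x|^2 + |y|^2] ([hnormE]), so a real matrix has the
    same bound on complex vectors ([hnorm_mulmx_le]).  The suprema are also
    shown to bound the ratios, that is, to be finite ([gnorm_mulmx_le]).

    Secondly, the orthogonal projections add up to the identity only because
    the metric built from the frames makes their spans mutually orthogonal
    ([frame_ortho], [orth_proj_frame_sum]). *)

(** * Inner products given by Gram matrices *)

Section BilinearForm.
Variables (R : realType) (n : nat) (G : 'M[R]_n).
Implicit Types u v w : 'rV[R]_n.

Lemma gdotDl u v w : gdot G (u + v) w = gdot G u w + gdot G v w.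
Proof. by rewrite /gdot !mulmxDl mxE. Qed.

Lemma gdotDr u v w : gdot G u (v + w) = gdot G u v + gdot G u w.
Proof. by rewrite /gdot linearD mulmxDr mxE. Qed.

Lemma gdotZl a u v : gdot G (a *: u) v = a * gdot G u v.
Proof. by rewrite /gdot -!scalemxAl mxE. Qed.

Lemma gdotZr a u v : gdot G u (a *: v) = a * gdot G u v.
Proof. by rewrite /gdot linearZ -scalemxAr mxE. Qed.

Lemma gdot0l v : gdot G 0 v = 0.
Proof. by rewrite /gdot !mul0mx mxE. Qed.

Lemma gnorm_ge0 v : 0 <= gnorm G v.
Proof. exact: sqrtr_ge0. Qed.

Lemma gnorm0 : gnorm G 0 = 0.
Proof. by rewrite /gnorm gdot0l sqrtr0. Qed.

Lemma gnormZ a v : gnorm G (a *: v) = `|a| * gnorm G v.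
Proof.
by rewrite /gnorm gdotZl gdotZr mulrA -expr2 sqrtrM ?sqr_ge0// sqrtr_sqr.
Qed.

End BilinearForm.

Definition posdef (R : realType) (n : nat) (G : 'M[R]_n) : Prop :=
  G^T = G /\ forall v : 'rV[R]_n, v != 0 -> 0 < gdot G v v.

Section InnerProduct.
Variables (R : realType) (n : nat) (G : 'M[R]_n) (Gpos : posdef G).
Implicit Types u v w : 'rV[R]_n.

Lemma gdot_ge0 v : 0 <= gdot G v v.
Proof.
by have [->|/Gpos.2/ltW//] := eqVneq v 0; rewrite gdot0l.
Qed.

Lemma gdotC u v : gdot G u v = gdot G v u.
Proof.
by rewrite /gdot -[u *m G *m v^T]trmxK mxE !trmx_mul trmxK Gpos.1 mulmxA.
Qed.

Lemma gnorm_sqr v : gnorm G v ^+ 2 = gdot G v v.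
Proof. by rewrite sqr_sqrtr ?gdot_ge0. Qed.

Lemma gnorm_gt0 v : v != 0 -> 0 < gnorm G v.
Proof. by move=> v0; rewrite sqrtr_gt0 Gpos.2. Qed.

(** The form is nonnegative at a multiple of the component of [u] orthogonal
    to [v]. *)
Lemma gdot_CauchySchwarz u v : `|gdot G u v| <= gnorm G u * gnorm G v.
Proof.
have [->|v0] := eqVneq v 0; first by rewrite gdotC gdot0l normr0 gnorm0 mulr0.
rewrite -ler_sqr ?nnegrE ?mulr_ge0 ?gnorm_ge0//.
rewrite exprMn !gnorm_sqr real_normK ?num_real//.
pose w := gdot G v v *: u + (- gdot G u v) *: v.
have := gdot_ge0 w.
rewrite gdotDl !gdotDr !gdotZl !gdotZr (gdotC v u).
have := Gpos.2 _ v0.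
move: (gdot G v v) (gdot G u v) (gdot G u u) => a b c a0.
have -> : a * (a * c) + a * (- b * b) + (- b * (a * b) + - b * (- b * a))
          = a * (c * a - b ^+ 2) by ring.
by rewrite pmulr_rge0// subr_ge0.
Qed.

Lemma gnormD u v : gnorm G (u + v) <= gnorm G u + gnorm G v.
Proof.
rewrite -ler_sqr ?nnegrE ?addr_ge0 ?gnorm_ge0// sqrrD !gnorm_sqr.
rewrite gdotDl !gdotDr (gdotC v u).
have := le_trans (ler_norm _) (gdot_CauchySchwarz u v).
by rewrite mulr2n; lra.
Qed.

Lemma gnorm_sum (I : Type) (r : seq I) (P : pred I) (F : I -> 'rV[R]_n) :
  gnorm G (\sum_(i <- r | P i) F i) <= \sum_(i <- r | P i) gnorm G (F i).
Proof.
elim/big_ind2: _ => [|x a y b xa yb|//]; first by rewrite gnorm0.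
exact: le_trans (gnormD _ _) (lerD xa yb).
Qed.

Lemma posdef_unit : G \in unitmx.
Proof.
rewrite -row_free_unit -kermx_eq0; apply: contraT => /rowV0Pn[v /sub_kermxP vG v0].
by have := Gpos.2 _ v0; rewrite /gdot vG mul0mx mxE ltxx.
Qed.

(** The coordinate [v_k] is the inner product of [v] with [e_k G^-1]. *)
Lemma gnorm_coord_le v (k : 'I_n) :
  `|v 0 k| <= gnorm G v * gnorm G (delta_mx 0 k *m invmx G).
Proof.
have -> : v 0 k = gdot G v (delta_mx 0 k *m invmx G).
  rewrite /gdot trmx_mul trmx_inv Gpos.1 mulmxA mulmxK ?posdef_unit//.
  rewrite trmx_delta mxE (bigD1 k)//= big1 ?addr0 => [|j /negPf jk].
    by rewrite mxE !eqxx mulr1.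
  by rewrite mxE jk mulr0.
exact: gdot_CauchySchwarz.
Qed.

(** Needed because the supremum of an unbounded set is a junk value: without
    it, [opnorm] would bound nothing. *)
Lemma gnorm_mulmx_bounded (B : 'M[R]_n) :
  exists K, forall v, gnorm G (v *m B) <= K * gnorm G v.
Proof.
exists (\sum_k gnorm G (delta_mx 0 k *m invmx G) * gnorm G (row k B)) => v.
rewrite mulmx_sum_row (le_trans (gnorm_sum _ _ _))// mulr_suml.
apply: ler_sum => k _; rewrite gnormZ [leRHS]mulrAC ler_wpM2r ?gnorm_ge0//.
by rewrite mulrC gnorm_coord_le.
Qed.

Lemma gnorm_mulmx_le m (E : 'M[R]_(m, n)) (B : 'M[R]_n) v :
  (v <= E)%MS -> gnorm G (v *m B) <= opnorm G E B * gnorm G v.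
Proof.
move=> vE; have [->|v0] := eqVneq v 0; first by rewrite mul0mx gnorm0 mulr0.
rewrite -ler_pdivrMr ?gnorm_gt0//; apply: ub_le_sup; last by exists v.
have [K KB] := gnorm_mulmx_bounded B.
by exists K => _ [w [_ w0] <-]; rewrite ler_pdivrMr ?gnorm_gt0.
Qed.

Lemma opnorm_ge0 m (E : 'M[R]_(m, n)) (B : 'M[R]_n) : 0 <= opnorm G E B.
Proof.
have [[v [vE v0]]|noE] := pselect (exists v, (v <= E)%MS /\ v != 0).
  have := le_trans (gnorm_ge0 _ _) (gnorm_mulmx_le B vE).
  by rewrite pmulr_lge0// gnorm_gt0.
rewrite /opnorm (_ : [set _ | _ in _] = set0) ?sup0//.
by rewrite -subset0 => a [w wE _]; case: noE; exists w.
Qed.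

End InnerProduct.

(** * The Hermitian norm on the complexification *)

Section Complexification.
Variables (R : realType) (n : nat).
Implicit Types (z : 'rV[R[i]]_n) (G B : 'M[R]_n).

Definition re_mx z : 'rV[R]_n := map_mx (@complex.Re R) z.
Definition im_mx z : 'rV[R]_n := map_mx (@complex.Im R) z.

Lemma re_im_mx z : z = complexify (re_mx z) + 'i%C *: complexify (im_mx z).
Proof.
by apply/rowP=> k; rewrite !mxE -complexE.
Qed.

Lemma conj_re_im_mx z :
  map_mx (@conjc R) z = complexify (re_mx z) - 'i%C *: complexify (im_mx z).
Proof.
apply/rowP=> k; rewrite !mxE; case: (z 0 k) => a b.
by simpc.
Qed.

Lemma complexifyM m p q (A : 'M[R]_(m, p)) (B : 'M[R]_(p, q)) :
  complexify (A *m B) = complexify A *m complexify B.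
Proof. exact: map_mxM. Qed.

Lemma re_mxM z B : re_mx (z *m complexify B) = re_mx z *m B.
Proof.
apply/rowP=> k; rewrite !mxE raddf_sum; apply: eq_bigr => j _.
by rewrite !mxE; case: (z 0 j) => a b; simpc.
Qed.

Lemma im_mxM z B : im_mx (z *m complexify B) = im_mx z *m B.
Proof.
apply/rowP=> k; rewrite !mxE raddf_sum; apply: eq_bigr => j _.
by rewrite !mxE; case: (z 0 j) => a b; simpc.
Qed.

Lemma hnormE G z : hnorm G z =
  Num.sqrt (gdot G (re_mx z) (re_mx z) + gdot G (im_mx z) (im_mx z)).
Proof.
rewrite /hnorm conj_re_im_mx {1}(re_im_mx z); congr Num.sqrt.
move: (re_mx z) (im_mx z) => x y.
rewrite linearB linearZ /= !mulmxDl !mulmxBr -!scalemxAl -!scalemxAr.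
have entryE u v : (complexify u *m complexify G *m (complexify v)^T) 0 0
    = (gdot G u v)%:C%C.
  by rewrite /complexify map_trmx -!map_mxM mxE.
move: (entryE x x) (entryE x y) (entryE y x) (entryE y y).
move: (_ *m (complexify x)^T) (_ *m (complexify y)^T).
move: (_ *m (complexify x)^T) (_ *m (complexify y)^T) => yx yy xx xy.
by rewrite !mxE => -> -> -> ->; simpc.
Qed.

(** The Hermitian extension of [G] to [C^n] is, on the real and imaginary
    parts, the inner product [G + G] of [R^(2n)]; triangle inequalities are
    inherited from there. *)
Lemma hnorm_real G z :
  hnorm G z = gnorm (block_mx G 0 0 G) (row_mx (re_mx z) (im_mx z)).
Proof.
rewrite hnormE /gnorm /gdot mul_row_block !mulmx0 addr0 add0r.
by rewrite tr_row_mx mul_row_col [in RHS]mxE.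
Qed.

Lemma hnormN G z : hnorm G (- z) = hnorm G z.
Proof.
by rewrite /hnorm map_mxN mulNmx linearN /= mulNmx mulmxN opprK.
Qed.

Section HermitianNorm.
Variable G : 'M[R]_n.
Hypothesis Gpos : posdef G.

Lemma posdef_block : posdef (block_mx G 0 0 G).
Proof.
split=> [|v]; first by rewrite tr_block_mx !trmx0 Gpos.1.
rewrite -[v]hsubmxK; move: (lsubmx v) (rsubmx v) => x y.
rewrite row_mx_eq0 /gdot mul_row_block !mulmx0 addr0 add0r.
rewrite tr_row_mx mul_row_col mxE negb_and.
by case/orP=> [/Gpos.2 x0|/Gpos.2 y0];
  [apply: ltr_wpDr|apply: ltr_wpDl] => //; exact: gdot_ge0.
Qed.

Lemma hnorm_gt0 z : z != 0 -> 0 < hnorm G z.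
Proof.
move=> z0; rewrite hnorm_real gnorm_gt0//; first exact: posdef_block.
apply: contraNneq z0 => /eqP; rewrite row_mx_eq0 => /andP[/eqP x0 /eqP y0].
by rewrite (re_im_mx z) x0 y0 /complexify map_mx0 scaler0 addr0.
Qed.

Lemma hnorm_sum (I : Type) (r : seq I) (P : pred I) (F : I -> 'rV[R[i]]_n) :
  hnorm G (\sum_(i <- r | P i) F i) <= \sum_(i <- r | P i) hnorm G (F i).
Proof.
elim/big_ind2: _ => [|x a y b xa yb|//].
  by rewrite /hnorm !mul0mx mxE sqrtr0.
apply: le_trans (lerD xa yb); rewrite !hnorm_real.
rewrite /re_mx /im_mx !map_mxD -add_row_mx.
exact: gnormD posdef_block _ _.
Qed.

(** Complexification does not increase the operator norm of a real matrix,
    since the latter acts on the real and imaginary parts separately. *)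
Lemma hnorm_mulmx_le m (E : 'M[R]_(m, n)) (B : 'M[R]_n) z :
  (re_mx z <= E)%MS -> (im_mx z <= E)%MS ->
  hnorm G (z *m complexify B) <= opnorm G E B * hnorm G z.
Proof.
move=> xE yE; have K0 := opnorm_ge0 Gpos E B.
rewrite !hnormE re_mxM im_mxM -!gnorm_sqr//.
rewrite -[X in X * _]ger0_norm// -sqrtr_sqr -sqrtrM ?sqr_ge0//.
rewrite ler_wsqrtr// mulrDr -!exprMn.
by apply: lerD; rewrite ler_sqr ?nnegrE ?mulr_ge0 ?gnorm_ge0// gnorm_mulmx_le.
Qed.

Lemma sigma_min_le m (E : 'M[R]_(m, n)) (B : 'M[R[i]]_n) z :
  (z <= complexify E)%MS -> z != 0 ->
  (sigma_min G E B <= (hnorm G (z *m B) / hnorm G z)%:E)%E.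
Proof. by move=> zE z0; apply: ereal_inf_lbound; exists z. Qed.

End HermitianNorm.

End Complexification.

(** * Block diagonal dominance *)

Section BlockDominance.
Variables (R : realType) (n N : nat) (G A : 'M[R]_n) (d : 'I_N -> nat).
Variables (E : forall i, 'M[R]_(d i, n)) (P : 'I_N -> 'M[R]_n) (chi : 'I_N -> R).
Hypotheses (Gpos : posdef G) (P_sum : \sum_i P i = 1%:M).
Hypotheses (P_idem : forall i, P i *m P i = P i).
Hypotheses (P_sub : forall i, (P i <= E i)%MS) (chi_gt0 : forall i, 0 < chi i).
Hypothesis dominance : forall i : 'I_N,
  ((\sum_(j < N | j != i)
      opnorm G (E j) (P j *m A *m P i) * (chi j / chi i))%:E
   < ereal_inf [set sigma_min G (E i) (complexify (P i *m A *m P i) - s%:M)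
                  | s in [set s : R[i] | (0 <= complex.Re s)%R]])%E.

(** For an eigenvector [z] of an eigenvalue [s] with [Re s >= 0], the
    dominance inequality fails at the index [i] for which the component
    [z P_i], measured in units of [chi_i], is largest. *)
Lemma block_dominance_hurwitz : hurwitz A.
Proof.
move=> s /eigenvalueP[z zA z0]; rewrite ltNge; apply/negP=> s_ge0.
pose zc j := z *m complexify (P j).
have z_sum : \sum_j zc j = z.
  rewrite -mulmx_sumr -(raddf_sum (map_mx (real_complex R))) P_sum.
  by rewrite /= map_mx1 mulmx1.
have zcK j : zc j *m complexify (P j) = zc j.
  by rewrite -mulmxA -complexifyM P_idem.
have zc_block i j :
    zc j *m complexify (P j *m A *m P i) = zc j *m complexify (A *m P i).
  by rewrite -mulmxA complexifyM mulmxA zcK.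
have zc_eq i : \sum_j zc j *m complexify (P j *m A *m P i) = s *: zc i.
  under eq_bigr do rewrite zc_block.
  by rewrite -mulmx_suml z_sum complexifyM mulmxA zA scalemxAl.
have [i0 zi0] : exists i, zc i != 0.
  apply/existsP; apply: contraNT z0 => /existsPn zc0.
  by rewrite -z_sum big1// => j _; apply/eqP; rewrite -[_ == _]negbK zc0.
pose q j := hnorm G (zc j) / chi j.
have [i _ i_max] := arg_maxP q (erefl : predT i0).
have q_gt0 : 0 < q i.
  by apply: lt_le_trans (i_max i0 _) => //; rewrite divr_gt0// hnorm_gt0.
have zi_gt0 : 0 < hnorm G (zc i) by move: q_gt0; rewrite pmulr_lgt0// invr_gt0.
have zi_neq0 : zc i != 0.
  by apply: contraTneq zi_gt0 => ->; rewrite /hnorm !mul0mx mxE sqrtr0 ltxx.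
have ziE : (zc i <= complexify (E i))%MS.
  by rewrite (submx_trans (submxMl _ _))// map_submx.
have off_diag : zc i *m (complexify (P i *m A *m P i) - s%:M)
    = - \sum_(j | j != i) zc j *m complexify (P j *m A *m P i).
  rewrite mulmxBr mul_mx_scalar -zc_eq (bigD1 i)//=.
  by rewrite opprD addrA subrr sub0r.
have := dominance i; rewrite ltNge => /negP; apply.
apply: le_trans (ereal_inf_lbound _) _; first by exists s.
apply: le_trans (sigma_min_le _ _ ziE zi_neq0) _.
rewrite lee_fin ler_pdivrMr// off_diag hnormN mulr_suml.
apply: le_trans (hnorm_sum Gpos _ _ _) _; apply: ler_sum => j _.
have zjE (x : 'rV[R]_n) : (x *m P j <= E j)%MS.
  by rewrite (submx_trans (submxMl _ _)).
have zj_re : (re_mx (zc j) <= E j)%MS by rewrite re_mxM.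
have zj_im : (im_mx (zc j) <= E j)%MS by rewrite im_mxM.
apply: le_trans (hnorm_mulmx_le Gpos _ zj_re zj_im) _.
rewrite -mulrA ler_wpM2l ?opnorm_ge0//.
by rewrite mulrAC -mulrA mulrC -ler_pdivrMr//; exact: i_max.
Qed.

End BlockDominance.

Lemma hurwitz_unit (R : realType) (n : nat) (A : 'M[R]_n) :
  hurwitz A -> A \in unitmx.
Proof.
move=> A_hurw; rewrite -(map_unitmx (real_complex R)) -row_free_unit -kermx_eq0.
apply: contraT => /rowV0Pn[v /sub_kermxP vA v0].
have : eigenvalue (complexify A) 0.
  by apply/eigenvalueP; exists v; rewrite ?scale0r.
by move/A_hurw; rewrite /= ltxx.
Qed.

(** * Orthogonal projections for the metric of a frame *)

Lemma mulmx_tr_ge0 (R : realType) m (v : 'rV[R]_m) : 0 <= (v *m v^T) 0 0.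
Proof. by rewrite mxE sumr_ge0// => k _; rewrite mxE -expr2 sqr_ge0. Qed.

Lemma mulmx_tr_eq0 (R : realType) m p (B : 'M[R]_(m, p)) :
  B *m B^T = 0 -> B = 0.
Proof.
move=> BB0; apply/matrixP=> i k; rewrite mxE.
have /eqP := congr1 (fun D : 'M[R]_m => D i i) BB0; rewrite !mxE psumr_eq0.
  by move=> /allP/(_ k (mem_index_enum _)); rewrite mxE -expr2 sqrf_eq0 => /eqP.
by move=> j _; rewrite mxE -expr2 sqr_ge0.
Qed.

Lemma posdef_invmx (R : realType) n (C : 'M[R]_n) : posdef C -> posdef (invmx C).
Proof.
move=> Cpos; have C_unit := posdef_unit Cpos.
split=> [|v v0]; first by rewrite trmx_inv Cpos.1.
have -> : gdot (invmx C) v v = gdot C (v *m invmx C) (v *m invmx C).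
  by rewrite /gdot trmx_mul trmx_inv Cpos.1 mulmxKV// mulmxA.
apply: Cpos.2; apply: contraNneq v0 => vC.
by rewrite -[v](mulmxKV C_unit) vC mul0mx.
Qed.

Section OrthogonalProjection.
Variables (R : realType) (n m : nat) (G : 'M[R]_n) (E : 'M[R]_(m, n)).
Hypothesis Gpos : posdef G.

(** [proj_mx] is a projection only between subspaces that meet trivially. *)
Lemma capmx_orth : (<<E>> :&: kermx (G *m E^T))%MS = 0.
Proof.
apply/eqP/rowV0P=> v; rewrite sub_capmx genmxE => /andP[/submxP[c vE]].
move=> /sub_kermxP vGE; apply/eqP; apply: contraT => /Gpos.2.
by rewrite /gdot {2}vE trmx_mul mulmxA -(mulmxA v) vGE mul0mx mxE ltxx.
Qed.

Lemma orth_proj_idem : orth_proj G E *m orth_proj G E = orth_proj G E.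
Proof. exact: proj_mx_proj capmx_orth. Qed.

Lemma orth_proj_sub : (orth_proj G E <= E)%MS.
Proof. by rewrite -[orth_proj G E]mul1mx -(genmxE E) proj_mx_sub. Qed.

Lemma orth_proj_id p (B : 'M[R]_(p, n)) :
  (B <= E)%MS -> B *m orth_proj G E = B.
Proof. by move=> BE; rewrite proj_mx_id ?genmxE//; exact: capmx_orth. Qed.

Lemma orth_proj_0 p (B : 'M[R]_(p, n)) :
  B *m G *m E^T = 0 -> B *m orth_proj G E = 0.
Proof.
move=> BGE; rewrite proj_mx_0//; first exact: capmx_orth.
by apply/sub_kermxP; rewrite mulmxA.
Qed.

End OrthogonalProjection.

Section FrameMetric.
Variables (R : realType) (n N : nat) (d : 'I_N -> nat).
Variable F : forall i, 'M[R]_(d i, n).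
Hypothesis F_direct : mxdirect (\sum_(i < N) <<F i>>)%MS.
Hypothesis F_total : ((\sum_(i < N) <<F i>>) :=: 1%:M)%MS.

Let C := \sum_i (F i)^T *m F i.

(** The rows of the [F i] together span the whole space. *)
Lemma mulmx_eq0_frame p (B : 'M[R]_(n, p)) :
  (forall i, F i *m B = 0) -> B = 0.
Proof.
move=> FB; rewrite -[B]mul1mx; apply/sub_kermxP.
rewrite -F_total; apply/sumsmx_subP=> i _.
by rewrite genmxE; apply/sub_kermxP.
Qed.

(** [v C v^T] is the sum of the squares of the values of the covector [v] on
    the vectors of the frame, which span. *)
Lemma posdef_frame : posdef C.
Proof.
split=> [|v].
  rewrite linear_sum; apply: eq_bigr => i _.
  by rewrite /= trmx_mul trmxK.
have gdotE : gdot C v v = \sum_i ((v *m (F i)^T) *m (v *m (F i)^T)^T) 0 0.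
  rewrite /gdot mulmx_sumr mulmx_suml summxE; apply: eq_bigr => i _.
  by rewrite trmx_mul trmxK !mulmxA.
move=> v0; rewrite lt_neqAle eq_sym gdotE sumr_ge0 ?andbT => [|i _]; last first.
  exact: mulmx_tr_ge0.
apply: contraNneq v0 => /eqP; rewrite psumr_eq0 => [/allP vF|i _]; last first.
  exact: mulmx_tr_ge0.
rewrite -[v]trmxK (_ : v^T = 0) ?trmx0//; apply: mulmx_eq0_frame => i.
rewrite -[F i]trmxK -trmx_mul (_ : v *m _ = 0) ?trmx0//; apply: mulmx_tr_eq0.
by apply/rowP=> k; rewrite !ord1 [RHS]mxE; apply/eqP/vF; rewrite mem_index_enum.
Qed.

(** With [K = F_j C^-1], the equality [K C = F_j] writes the rows of [F_j] as
    sums of the terms [K F_k^T F_k], whose rows lie in the span of [F_k].  The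
    rows of [F_j] lie in the span of [F_j], so by directness the terms with
    [k != j] vanish, and [K F_i^T F_i = 0] forces [K F_i^T = 0] because
    [(K F_i^T) (K F_i^T)^T = K F_i^T F_i K^T]. *)
Lemma frame_ortho i j : i != j -> F j *m invmx C *m (F i)^T = 0.
Proof.
move=> ij; set K := F j *m invmx C.
pose T k := K *m (F k)^T *m F k.
have T_sum : \sum_k T k = F j.
  rewrite /T; under eq_bigr do rewrite -mulmxA.
  by rewrite -mulmx_sumr -/C mulmxKV// posdef_unit//; exact: posdef_frame.
have T_sub k : (T k <= <<F k>>)%MS by rewrite genmxE submxMl.
have Ti0 : T i = 0.
  apply/eqP; rewrite -submx0.
  have <- := mxdirect_sumsP F_direct i isT.
  rewrite sub_capmx T_sub /=.
  have -> : T i = F j - \sum_(k | k != i) T k.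
    by rewrite -T_sum (bigD1 i)//= addrK.
  rewrite addmx_sub//; last first.
    by rewrite eqmx_opp summx_sub_sums.
  by rewrite (sumsmx_sup j) ?genmxE// eq_sym.
apply: mulmx_tr_eq0.
by rewrite trmx_mul trmxK mulmxA -/(T i) Ti0 mul0mx.
Qed.

(** Both sides fix the rows of every [F j]: [orth_proj _ (F j)] does by
    definition, and the other projections kill them by orthogonality. *)
Lemma orth_proj_frame_sum : \sum_i orth_proj (invmx C) (F i) = 1%:M.
Proof.
have Gpos := posdef_invmx posdef_frame.
apply/eqP; rewrite -subr_eq0; apply/eqP/mulmx_eq0_frame => j.
rewrite mulmxBr mulmx1 mulmx_sumr (bigD1 j)//= orth_proj_id//.
by rewrite big1 ?addr0 ?subrr// => i ij; rewrite orth_proj_0// frame_ortho.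
Qed.

End FrameMetric.

(** * The intrinsic Jacobian *)

Lemma cometricE (R : realType) n (M : smoothManifold R n) N (d : 'I_N -> nat)
    (f : forall i : 'I_N, 'I_(d i) -> vfield M) x :
  cometric f x = \sum_i (span_of (f i) x)^T *m span_of (f i) x.
Proof.
apply: eq_bigr => i _; apply/matrixP=> k l.
rewrite summxE [RHS]mxE; apply: eq_bigr => j _.
by rewrite !mxE big_ord1 mxE.
Qed.

Theorem proposition2 (R : realType) (n : nat) (M : smoothManifold R n)
  (N : nat) (d : 'I_N -> nat) (f : forall i : 'I_N, 'I_(d i) -> vfield M)
  (J : 'I_N -> M -> R)
  (f_smooth : forall i j, smooth_vfield [set: M] (f i j))
  (J_smooth : forall i, smooth_fun [set: M] (J i))
  (U : set M) (U_open : open U)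
  (E_regular : forall i, regular_distribution U (f i))
  (E_direct : forall x, U x ->
     mxdirect (\sum_(i < N) <<span_of (f i) x>>)%MS)
  (E_total : forall x, U x ->
     ((\sum_(i < N) <<span_of (f i) x>>) :=: 1%:M)%MS)
  (nabla : connection M) (nabla_LC : levi_civita U (metric f) nabla)
  (xs : M) (xs_U : U xs)
  (xs_crit : forall i, sub_grad f J i xs = 0)
  (chi : 'I_N -> R) (chi_gt0 : forall i, 0 < chi i)
  (dominance : forall i : 'I_N,
     ((\sum_(j < N | j != i)
         opnorm (metric f xs) (span_of (f j) xs)
                (jacobian_block f J nabla i j xs) * (chi j / chi i))%:E
      < ereal_inf
          [set sigma_min (metric f xs) (span_of (f i) xs)
                 (complexify (jacobian_block f J nabla i i xs) - s%:M)
             | s in [set s : R[i] | (0 <= complex.Re s)%R]])%E) :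
  intrinsic_jacobian f J nabla xs \in unitmx /\
  hurwitz (intrinsic_jacobian f J nabla xs).
Proof.
have xs_direct := E_direct xs xs_U; have xs_total := E_total xs xs_U.
have metricE : metric f xs
    = invmx (\sum_i (span_of (f i) xs)^T *m span_of (f i) xs).
  by rewrite /metric cometricE.
have Gpos : posdef (metric f xs).
  by rewrite metricE; exact: posdef_invmx (posdef_frame xs_total).
suff A_hurwitz : hurwitz (intrinsic_jacobian f J nabla xs).
  by split=> //; exact: hurwitz_unit.
apply: (block_dominance_hurwitz Gpos (P := fun i => sub_proj f i xs)
          (E := fun i => span_of (f i) xs) _ _ _ chi_gt0 dominance).
- by rewrite /sub_proj metricE; exact: orth_proj_frame_sum.
- by move=> i; exact: orth_proj_idem.
- by move=> i; exact: orth_proj_sub.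
Qed.
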